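(* Let $\mathbb F$ be a field of characteristic $0$. Let $H$ be a twin-free $\mathbb F$-weighted graph (directed or undirected). Then for every $k \ge 0$ and $n \ge 2$, $\mathcal G'[k] \cong \mathbb F^{r_k}$ as algebras, where \[ r_k = \dim \mathcal G'[k] = \operatorname{rk_S} T(k, n, H) = \operatorname{rank} T(k, n, H) = \operatorname{rank} M(k, H) = \operatorname{rank} N(k, H) = \operatorname{orb}_k(H). \] In particular, if $H$ has no nontrivial $\mathbb F$-weighted automorphisms, then all these quantities equal $|V(H)|^k$.
   Context: An $\mathbb F$-weighted graph $H$ consists of a finite vertex set $V(H)$, vertex weights $\alpha_H(i)\in\mathbb F\setminus\{0\}$ and edge weights $\beta_H(i,j)\in\mathbb F$ for all ordered pairs $(i,j)$ (symmetric if undirected). $H$ is twin-free if there are no distinct $i,j$ with $\beta_H(i,\ell)=\beta_H(j,\ell)$ and $\beta_H(\ell,i)=\beta_H(\ell,j)$ for all $\ell$. $\operatorname{Aut}(H)$ is the group of bijections of $V(H)$ preserving all vertex and edge weights; it acts on $V(H)^k=\{\varphi\colon[k]\to V(H)\}$ by $\varphi\mapsto\sigma\circ\varphi$, and $\operatorname{orb}_k(H)$ is the number of orbits. A $k$-labeled graph is a finite graph (directed iff $H$ is), without loops but possibly with multiple edges, with $k$ distinct nodes labeled $1,\dots,k$; $\mathcal{PLG}[k]$ is the set of their isomorphism classes (label-preserving), and $U_k$ is the graph with $k$ labeled nodes and no edges. The product $G_1G_2$ of $k$-labeled graphs is their disjoint union with equally labeled nodes identified. $\mathcal G[k]$ is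 the $\mathbb F$-algebra with basis $\mathcal{PLG}[k]$ and this product (identity $U_k$). For $\varphi\colon[k]\to V(H)$, $\hom_\varphi(G,H)=\sum_{\phi}\prod_{u\text{ unlabeled}}\alpha_H(\phi(u))\prod_{uv\in E(G)}\beta_H(\phi(u),\phi(v))$ over $\phi\colon V(G)\to V(H)$ mapping the node labeled $i$ to $\varphi(i)$ (edges with multiplicity; directed edge $u\to v$ gives $\beta_H(\phi(u),\phi(v))$; $0^0=1$). $f_H(G)=\hom(G,H)=\sum_{\phi\colon V(G)\to V(H)}\prod_{u\in V(G)}\alpha_H(\phi(u))\prod_{uv\in E(G)}\beta_H(\phi(u),\phi(v))$ (labels ignored), extended linearly to $\mathcal G[k]$. $\mathcal K_{[k]}=\{x\in\mathcal G[k]: f_H(xy)=0\ \forall y\in\mathcal G[k]\}$ is an ideal and $\mathcal G'[k]=\mathcal G[k]/\mathcal K_{[k]}$; $\mathbb F^{r}$ carries componentwise multiplication. The connection tensor $T(k,n,H)$ is the function $\mathcal{PLG}[k]^n\to\mathbb F$, $(G_1,\dots,G_n)\mapsto f_H(G_1\cdots G_n)$, and $M(k,H)=T(k,2,H)$ (the connection matrix). Its rank is the least $r$ such that $T(G_1,\dots,G_n)=\sum_{i=1}^r a_i\prod_{j=1}^n \mathbf f_{ij}(G_j)$ for all arguments, for some $a_i\in\mathbb F$ and functions $\mathbf f_{ij}\colon\mathcal{PLG}[k]\to\mathbb F$ ($\infty$ if none); its symmetric rank $\operatorname{rk_S}$ is the least $r$ with $T(G_1,\dots,G_n)=\sum_{i=1}^r\lambda_i\prod_{j=1}^n\mathbf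 f_i(G_j)$. $N(k,H)$ is the matrix with rows indexed by $\varphi\in V(H)^k$, columns indexed by $\mathcal{PLG}[k]$ and $(\varphi,G)$-entry $\hom_\varphi(G,H)$. Matrix rank of a possibly infinite matrix is the dimension of its row space (equivalently, the largest size of a nonzero minor). *)

(* Defs.v *)
From HB Require Import structures.
From mathcomp Require Import all_boot all_order all_fingroup all_algebra.
From mathcomp Require Import generic_quotient ring_quotient.
From mathcomp Require Import finmap boolp functions monalg.

Set Implicit Arguments.
Unset Strict Implicit.
Unset Printing Implicit Defensive.

Import GRing.Theory.
Local Open Scope ring_scope.
Local Open Scope quotient_scope.

Record wgraph (F : fieldType) := WGraph {
  vert :> finType;
  directed : bool;
  alpha : vert -> F;
  beta : vert -> vert -> F;
  alpha_neq0 : forall i, alpha i != 0;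
  beta_sym : ~~ directed -> forall i j, beta i j = beta j i
}.

Definition twin_free (F : fieldType) (H : wgraph F) : Prop :=
  forall i j : H,
    (forall l, beta i l = beta j l) -> (forall l, beta l i = beta l j) -> i = j.

Section Automorphisms.
Variables (F : fieldType) (H : wgraph F).

Definition wAut : {set {perm H}} :=
  [set s : {perm H} | [forall i, alpha (s i) == alpha i] &&
                      [forall i, forall j, beta (s i) (s j) == beta i j]].

Lemma wAutP (s : {perm H}) :
  reflect ((forall i, alpha (s i) = alpha i) /\
           (forall i j, beta (s i) (s j) = beta i j)) (s \in wAut).
Proof.
rewrite inE; apply: (iffP andP) => -[sa sb]; split.
- by move=> i; apply/eqP/(forallP sa).
- by move=> i j; apply/eqP; move/forallP: sb => /(_ i)/forallP.
- by apply/forallP => i; rewrite sa.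
- by apply/forallP => i; apply/forallP => j; rewrite sb.
Qed.

Fact wAut_group_set : group_set wAut.
Proof.
apply/group_setP; split=> [|s t /wAutP[sa sb] /wAutP[ta tb]].
  by apply/wAutP; split=> *; rewrite !perm1.
by apply/wAutP; split=> *; rewrite !permM ?ta ?sa ?tb ?sb.
Qed.
Canonical wAut_group := Group wAut_group_set.

Definition post_comp k (phi : {ffun 'I_k -> H}) (s : {perm H}) :
  {ffun 'I_k -> H} := [ffun i => s (phi i)].

Fact post_comp1 k : (@post_comp k)^~ 1%g =1 id.
Proof. by move=> phi; apply/ffunP=> i; rewrite ffunE perm1. Qed.

Fact post_compM k (phi : {ffun 'I_k -> H}) : act_morph (@post_comp k) phi.
Proof. by move=> s t; apply/ffunP=> i; rewrite !ffunE permM. Qed.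

Definition post_act k := TotalAction (@post_comp1 k) (@post_compM k).

Definition orb (k : nat) : nat :=
  #|orbit (post_act k) wAut @: [set: {ffun 'I_k -> H}]|.

End Automorphisms.

Definition node (k m : nat) : predArgType := ('I_k + 'I_m)%type.

Definition ledges k := {m : nat & seq (node k m * node k m)}.

(* A k-labeled loopless multigraph with m unlabeled nodes: the node labeled i
   is inl i, and every occurrence of a pair in the list is one edge. For
   undirected graphs the orientation of the pairs carries no meaning: it is
   disregarded by mult below, hence by isomorphism. *)
Record lgraph (k : nat) := LGraph {
  lgraph_val : ledges k;
  _ : all (fun e => e.1 != e.2) (tagged lgraph_val)
}.

HB.instance Definition _ k := [isSub for @lgraph_val k].
HB.instance Definition _ k := [Choice of lgraph k by <:].

Section LabeledGraphs.
Variable k : nat.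
Implicit Types G : lgraph k.

Definition unl G : nat := tag (lgraph_val G).
Definition edges G : seq (node k (unl G) * node k (unl G)) :=
  tagged (lgraph_val G).

Lemma loopless G : all (fun e => e.1 != e.2) (edges G).
Proof. by case: G. Qed.

Definition mult_seq (d : bool) (V : eqType) (E : seq (V * V)) (u v : V) : nat :=
  count (fun e => (e == (u, v)) || ~~ d && (e == (v, u))) E.

(* The number of edges from u to v (d = true), or between u and v (d = false). *)
Definition mult d G (u v : node k (unl G)) : nat := mult_seq d (edges G) u v.
Arguments mult d G u v : clear implicits.

Definition iso (d : bool) G1 G2 : Prop :=
  exists f : node k (unl G1) -> node k (unl G2),
    [/\ bijective f, forall i, f (inl i) = inl i
      & forall u v, mult d G2 (f u) (f v) = mult d G1 u v].

Lemma iso_refl d G : iso d G G.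
Proof. by exists id; split=> //; exists id. Qed.

Lemma iso_sym d G1 G2 : iso d G1 G2 -> iso d G2 G1.
Proof.
case=> f [[g fK gK] fl fm]; exists g; split; first by exists f.
  by move=> i; rewrite -fl fK.
by move=> u v; rewrite -fm !gK.
Qed.

Lemma iso_trans d G1 G2 G3 : iso d G1 G2 -> iso d G2 G3 -> iso d G1 G3.
Proof.
case=> f [fb fl fm] [g [gb gl gm]]; exists (g \o f); split.
- exact: bij_comp.
- by move=> i /=; rewrite fl gl.
- by move=> u v /=; rewrite gm fm.
Qed.

Definition isob d : rel (lgraph k) := fun G1 G2 => `[< iso d G1 G2 >].

Fact isob_equiv d : equiv_class_of (isob d).
Proof.
split=> [G|G1 G2|G2 G1 G3].
- exact/asboolP/iso_refl.
- by apply/asboolP/asboolP; apply: iso_sym.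
- by move=> /asboolP i12 /asboolP i23; apply/asboolP/(iso_trans i12).
Qed.
Canonical isob_equiv_rel d := EquivRelPack (isob_equiv d).

Definition emb_l m1 m2 (u : node k m1) : node k (m1 + m2) :=
  match u with inl i => inl i | inr a => inr (lshift m2 a) end.
Definition emb_r m1 m2 (u : node k m2) : node k (m1 + m2) :=
  match u with inl i => inl i | inr a => inr (rshift m1 a) end.

Definition map_edges (V W : Type) (f : V -> W) (E : seq (V * V)) :=
  [seq (f e.1, f e.2) | e <- E].

Lemma emb_l_inj m1 m2 : injective (@emb_l m1 m2).
Proof.
move=> [i|a] [j|b] // h; first by case: h => ->.
by have /lshift_inj-> : lshift m2 a = lshift m2 b := inr_inj h.
Qed.

Lemma emb_r_inj m1 m2 : injective (@emb_r m1 m2).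
Proof.
move=> [i|a] [j|b] // h; first by case: h => ->.
by have /rshift_inj-> : rshift m1 a = rshift m1 b := inr_inj h.
Qed.

Lemma map_edges_loopless (V W : eqType) (f : V -> W) (E : seq (V * V)) :
  injective f -> all (fun e => e.1 != e.2) E ->
  all (fun e => e.1 != e.2) (map_edges f E).
Proof.
move=> finj lE; rewrite all_map; apply: sub_all lE => -[u v] /=.
by rewrite (inj_eq finj).
Qed.

Definition gmul_val G1 G2 : ledges k :=
  Tagged (fun m => seq (node k m * node k m))
    (map_edges (@emb_l (unl G1) (unl G2)) (edges G1) ++
     map_edges (@emb_r (unl G1) (unl G2)) (edges G2)).

Fact gmul_loopless G1 G2 :
  all (fun e => e.1 != e.2) (tagged (gmul_val G1 G2)).
Proof.
rewrite all_cat !map_edges_loopless ?loopless //.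
- exact: emb_r_inj.
- exact: emb_l_inj.
Qed.

Definition gmul G1 G2 : lgraph k := LGraph (gmul_loopless G1 G2).

Definition gone : lgraph k :=
  @LGraph k (Tagged (fun m => seq (node k m * node k m))
               ([::] : seq (node k 0 * node k 0))) isT.

Lemma mult_seq_cat d (V : eqType) (E1 E2 : seq (V * V)) u v :
  mult_seq d (E1 ++ E2) u v = (mult_seq d E1 u v + mult_seq d E2 u v)%N.
Proof. exact: count_cat. Qed.

Lemma mult_seq_perm d (V : eqType) (E1 E2 : seq (V * V)) :
  perm_eq E1 E2 -> mult_seq d E1 =2 mult_seq d E2.
Proof. by move=> /seq.permP E12 u v; apply: E12. Qed.

Lemma mult_seq_map d (V W : eqType) (f : V -> W) (E : seq (V * V)) u v :
  injective f -> mult_seq d (map_edges f E) (f u) (f v) = mult_seq d E u v.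
Proof.
move=> finj; rewrite /mult_seq count_map; apply: eq_count => -[x y] /=.
by rewrite !xpair_eqE !(inj_eq finj).
Qed.

Lemma mult_seq_map0 d (V W : eqType) (f : V -> W) (E : seq (V * V)) u v :
  (forall w, f w <> u) \/ (forall w, f w <> v) ->
  mult_seq d (map_edges f E) u v = 0%N.
Proof.
move=> nuv; rewrite /mult_seq count_map; apply/eqP; rewrite -leqn0 leqNgt.
rewrite -has_count; apply/negP=> /hasP[[x y] _ /=].
rewrite !xpair_eqE => /orP[/andP[/eqP fx /eqP fy]|/and3P[_ /eqP fx /eqP fy]].
- by case: nuv => n; [apply: (n x) | apply: (n y)].
- by case: nuv => n; [apply: (n y) | apply: (n x)].
Qed.

Lemma mult_seq_square d (V1 V2 W1 W2 : finType) (E1 : seq (V1 * V1))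
    (E2 : seq (V2 * V2)) (f : V1 -> V2) (g : W1 -> W2) (h1 : V1 -> W1)
    (h2 : V2 -> W2) :
  bijective f -> injective g -> injective h1 -> injective h2 ->
  (forall u, g (h1 u) = h2 (f u)) ->
  (forall u v, mult_seq d E2 (f u) (f v) = mult_seq d E1 u v) ->
  forall u v, mult_seq d (map_edges h2 E2) (g u) (g v) =
              mult_seq d (map_edges h1 E1) u v.
Proof.
move=> [f' fK f'K] ginj h1i h2i gh fE u v.
have nim w : w \notin codom h1 -> (forall x, h1 x <> w) /\ (forall x, h2 x <> g w).
  move=> nw; split=> x xw; case/negP: nw.
    by rewrite -xw codom_f.
  by have -> : w = h1 (f' x) by [apply: ginj; rewrite gh f'K]; apply: codom_f.
have [/codomP[x ->]|/nim[u1 u2]] := boolP (u \in codom h1); last first.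
  by rewrite !mult_seq_map0 //; left.
have [/codomP[y ->]|/nim[v1 v2]] := boolP (v \in codom h1); last first.
  by rewrite !mult_seq_map0 //; right.
by rewrite !gh !mult_seq_map.
Qed.

Lemma iso_unl d G1 G2 : iso d G1 G2 -> unl G1 = unl G2.
Proof.
case=> f [fb _ _]; have := bij_eq_card fb.
by rewrite !card_sum !card_ord => /addnI.
Qed.

Lemma iso_of_perm d G1 G2 (f : node k (unl G1) -> node k (unl G2)) :
  bijective f -> (forall i, f (inl i) = inl i) ->
  perm_eq (map_edges f (edges G1)) (edges G2) -> iso d G1 G2.
Proof.
move=> fb fl fE; exists f; split=> // u v.
rewrite /mult -(mult_seq_perm d fE) mult_seq_map //; exact: bij_inj.
Qed.

Lemma gmul_iso d G1 G1' G2 G2' :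
  iso d G1 G1' -> iso d G2 G2' -> iso d (gmul G1 G2) (gmul G1' G2').
Proof.
move=> [f1 [f1b f1l f1m]] [f2 [f2b f2l f2m]].
pose g (u : node k (unl (gmul G1 G2))) : node k (unl (gmul G1' G2')) :=
  match u with
  | inl i => inl i
  | inr a => match fintype.split a with
             | inl b => @emb_l _ (unl G2') (f1 (inr b))
             | inr b => @emb_r (unl G1') _ (f2 (inr b))
             end
  end.
have gl u : g (emb_l (unl G2) u) = emb_l (unl G2') (f1 u).
  case: u => [i|a] /=; first by rewrite f1l.
  by rewrite (unsplitK (inl a)).
have gr u : g (emb_r (unl G1) u) = emb_r (unl G1') (f2 u).
  case: u => [i|a] /=; first by rewrite f2l.
  by rewrite (unsplitK (inr a)).
have gsurj (v : node k (unl (gmul G1' G2'))) : exists u, g u = v.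
  case: f1b => f1' _ f1K; case: f2b => f2' _ f2K.
  case: v => [i|a]; first by exists (inl i).
  rewrite -(fintype.splitK a); case: (fintype.split a) => b.
    exists (emb_l (unl G2) (f1' (inr b))); by rewrite gl f1K.
  exists (emb_r (unl G1) (f2' (inr b))); by rewrite gr f2K.
have gb : bijective g.
  pose h v := sval (cid (gsurj v)).
  have hK : cancel h g by move=> v; exact: (svalP (cid (gsurj v))).
  apply: (bij_can_bij _ hK); apply: (inj_card_bij (can_inj hK)).
  rewrite !card_sum !card_ord /unl /= leq_add2l.
  by rewrite (iso_unl (ex_intro _ f1 (And3 f1b f1l f1m)))
             (iso_unl (ex_intro _ f2 (And3 f2b f2l f2m))).
exists g; split=> // u v; rewrite /mult !mult_seq_cat; congr addn.
- apply: (mult_seq_square f1b (bij_inj gb) _ _ gl f1m); exact: emb_l_inj.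
- apply: (mult_seq_square f2b (bij_inj gb) _ _ gr f2m); exact: emb_r_inj.
Qed.

Lemma map_edges_comp (U V W : Type) (f : V -> W) (g : U -> V) E :
  map_edges f (map_edges g E) = map_edges (f \o g) E.
Proof. by rewrite /map_edges -map_comp. Qed.

Lemma eq_map_edges (V W : Type) (f g : V -> W) E :
  f =1 g -> map_edges f E = map_edges g E.
Proof. by move=> fg; apply: eq_map => -[u v]; rewrite !fg. Qed.

Lemma map_edges_cat (V W : Type) (f : V -> W) E1 E2 :
  map_edges f (E1 ++ E2) = map_edges f E1 ++ map_edges f E2.
Proof. exact: map_cat. Qed.

Definition node_map m1 m2 (f : 'I_m1 -> 'I_m2) (u : node k m1) : node k m2 :=
  match u with inl i => inl i | inr a => inr (f a) end.

Lemma node_map_bij m1 m2 (f : 'I_m1 -> 'I_m2) :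
  bijective f -> bijective (node_map f).
Proof.
case=> g fK gK; exists (node_map g); case=> //= a; congr inr; [exact: fK|exact: gK].
Qed.

Lemma cast_ord_bij m1 m2 (e : m1 = m2) : bijective (cast_ord e).
Proof. by exists (cast_ord (esym e)); [exact: cast_ordK|exact: cast_ordKV]. Qed.

Lemma perm_of_eq (T : eqType) (s t : seq T) : s = t -> perm_eq s t.
Proof. by move=> ->. Qed.

Lemma gmulA_iso d G1 G2 G3 :
  iso d (gmul G1 (gmul G2 G3)) (gmul (gmul G1 G2) G3).
Proof.
pose f := node_map (cast_ord (addnA (unl G1) (unl G2) (unl G3))).
apply: (@iso_of_perm d (gmul G1 (gmul G2 G3)) (gmul (gmul G1 G2) G3) f) => //.
  exact/node_map_bij/cast_ord_bij.
rewrite /edges /= !map_edges_cat !map_edges_comp catA.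
by apply: perm_of_eq; congr ((_ ++ _) ++ _); apply: eq_map_edges; case=> //= a;
  congr inr; apply: val_inj => //=; rewrite addnA.
Qed.

Lemma gmulC_iso d G1 G2 : iso d (gmul G1 G2) (gmul G2 G1).
Proof.
pose sw m n (a : 'I_(m + n)) : 'I_(n + m) :=
  match fintype.split a with inl b => rshift n b | inr b => lshift m b end.
have swK m n : cancel (@sw m n) (@sw n m).
  move=> a; rewrite /sw; case: (split_ordP a) => b ->.
    by rewrite (unsplitK (inr b)).
  by rewrite (unsplitK (inl b)).
pose f := node_map (@sw (unl G1) (unl G2)).
apply: (@iso_of_perm d (gmul G1 G2) (gmul G2 G1) f) => //.
  by apply: node_map_bij; exists (@sw (unl G2) (unl G1)).
rewrite /edges /= !map_edges_cat !map_edges_comp perm_catC.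
apply: perm_of_eq; congr (_ ++ _); apply: eq_map_edges; case=> //= a; congr inr.
  by rewrite /sw (unsplitK (inr a)).
by rewrite /sw (unsplitK (inl a)).
Qed.

Lemma gmul1_iso d G : iso d (gmul gone G) G.
Proof.
apply: (@iso_of_perm d (gmul gone G) G (node_map (cast_ord (add0n (unl G))))) => //.
  exact/node_map_bij/cast_ord_bij.
rewrite [edges (gmul _ _)]/edges /= map_edges_comp.
apply: perm_of_eq; rewrite -[RHS]map_id; apply: eq_map => -[[i|a] [j|b]] //=;
  congr (_, _); congr inr; exact: val_inj.
Qed.

Lemma iso_gone d G : iso d G gone <-> unl G = 0%N /\ edges G = [::].
Proof.
split=> [iG|].
  split; first exact: (iso_unl iG).
  case: iG => f [_ _ fm]; case E: (edges G) => [//|[u v] s].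
  have := fm u v; rewrite /mult E /mult_seq /= eqxx /=.
  by rewrite /edges /=.
case: G => -[m s] lG; rewrite /unl /edges /= => -[m0 s0]; subst m s.
by exists id; split=> //; exists id.
Qed.

Lemma gmul_eq1 d G1 G2 :
  iso d (gmul G1 G2) gone -> iso d G1 gone /\ iso d G2 gone.
Proof.
rewrite !iso_gone => -[/eqP]; rewrite addn_eq0 => /andP[/eqP m1 /eqP m2].
rewrite [edges (gmul _ _)]/edges /= => E; do !split=> //.
  by case: (edges G1) E.
by case: (edges G2) E => // e s; case: (edges G1).
Qed.

End LabeledGraphs.

Arguments mult {k} d G u v.

Definition PLG (d : bool) (k : nat) := {eq_quot (isob_equiv_rel k d)}.

HB.instance Definition _ d k := Choice.on (PLG d k).
HB.instance Definition _ d k : EqQuotient _ (isob_equiv_rel k d) (PLG d k) :=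
  EqQuotient.on (PLG d k).

Section LabeledGraphClasses.
Variables (d : bool) (k : nat).
Implicit Types x y z : PLG d k.

Definition plg_one : PLG d k := \pi_(PLG d k) (gone k).
Definition plg_mul x y : PLG d k := \pi_(PLG d k) (gmul (repr x) (repr y)).

Lemma pi_isoP (G1 G2 : lgraph k) :
  \pi_(PLG d k) G1 = \pi_(PLG d k) G2 <-> iso d G1 G2.
Proof.
split=> [/eqmodP/asboolP //|i12]; exact/eqmodP/asboolP.
Qed.

Lemma repr_pi_iso (G : lgraph k) : iso d (repr (\pi_(PLG d k) G)) G.
Proof. by apply/pi_isoP; rewrite reprK. Qed.

Lemma plg_mulE (G1 G2 : lgraph k) :
  plg_mul (\pi_(PLG d k) G1) (\pi_(PLG d k) G2) = \pi_(PLG d k) (gmul G1 G2).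
Proof. by apply/pi_isoP/gmul_iso; apply: repr_pi_iso. Qed.

Fact plg_mulA : associative plg_mul.
Proof.
move=> x y z; rewrite -[x]reprK -[y]reprK -[z]reprK.
move: (repr x) (repr y) (repr z) => G1 G2 G3.
rewrite (plg_mulE G2 G3) (plg_mulE G1 G2) !plg_mulE.
exact/pi_isoP/gmulA_iso.
Qed.

Fact plg_mulC : commutative plg_mul.
Proof. by move=> x y; apply/pi_isoP/gmulC_iso. Qed.

Fact plg_mul1 : left_id plg_one plg_mul.
Proof. by move=> x; rewrite -[x]reprK plg_mulE; apply/pi_isoP/gmul1_iso. Qed.

Fact plg_mulr1 : right_id plg_one plg_mul.
Proof. by move=> x; rewrite plg_mulC plg_mul1. Qed.

Fact plg_unit x y : plg_mul x y = plg_one -> x = plg_one /\ y = plg_one.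
Proof.
rewrite -[x]reprK -[y]reprK plg_mulE => /pi_isoP/gmul_eq1[ix iy].
by split; apply/pi_isoP.
Qed.

HB.instance Definition _ := Choice_isMonomialDef.Build (PLG d k)
  plg_mulA plg_mul1 plg_mulr1 plg_unit.
HB.instance Definition _ := MonomialDef_isConomialDef.Build (PLG d k) plg_mulC.

End LabeledGraphClasses.

Section Homomorphisms.
Variables (F : fieldType) (H : wgraph F) (k : nat).

Definition edge_weight (V : Type) (E : seq (V * V)) (psi : V -> H) : F :=
  \prod_(e <- E) beta (psi e.1) (psi e.2).

Definition hom_lab_graph (phi : {ffun 'I_k -> H}) (G : lgraph k) : F :=
  \sum_(psi : {ffun node k (unl G) -> H} | [forall i, psi (inl i) == phi i])
    (\prod_(u < unl G) alpha (psi (inr u))) * edge_weight (edges G) psi.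

Definition hom_graph (G : lgraph k) : F :=
  \sum_(psi : {ffun node k (unl G) -> H})
    (\prod_u alpha (psi u)) * edge_weight (edges G) psi.

Local Notation D := (directed H).

Lemma edge_weight_map (V W : Type) (f : V -> W) E (psi : W -> H) :
  edge_weight (map_edges f E) psi = edge_weight E (psi \o f).
Proof. by rewrite /edge_weight big_map. Qed.

Lemma edge_weight_mult (V : finType) (E1 E2 : seq (V * V)) (psi : V -> H) :
  all (fun e => e.1 != e.2) E1 -> all (fun e => e.1 != e.2) E2 ->
  mult_seq D E1 =2 mult_seq D E2 -> edge_weight E1 psi = edge_weight E2 psi.
Proof.
have [dH|ndH] := boolP D => l1 l2 E12.
  apply: perm_big; apply/allP => -[u v] _ /=; apply/eqP.
  have cT E : count_mem (u, v) E = mult_seq true E u v.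
    by apply: eq_count => e; rewrite /= orbF.
  by rewrite !cT E12.
pose lt (u v : V) := (enum_rank u < enum_rank v)%N.
pose o (e : V * V) := if lt e.1 e.2 then e else (e.2, e.1).
have oE E : edge_weight E psi = edge_weight (map o E) psi.
  rewrite /edge_weight big_map; apply: eq_bigr => e _; rewrite /o.
  by case: ifP => // _ /=; rewrite beta_sym.
have cE E u v : all (fun e => e.1 != e.2) E ->
    count_mem (u, v) (map o E) = if lt u v then mult_seq false E u v else 0%N.
  move=> /allP lE; rewrite count_map /mult_seq.
  have [uv|nuv] := boolP (lt u v).
    apply: eq_in_count => -[x y] /lE /= nxy; rewrite /o /=.
    have := uv; rewrite /lt => uv'.
    case: ifP => xy; rewrite !xpair_eqE.
      have [/andP[/eqP yv /eqP xu]|] := boolP ((x == v) && (y == u)).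
        by move: xy; rewrite yv xu ltnNge ltnW.
      by rewrite orbF.
    have [/andP[/eqP xu /eqP yv]|_] := boolP ((x == u) && (y == v)).
      by move: xy; rewrite xu yv uv'.
    by rewrite /= andbC.
  apply/eqP; rewrite -leqn0 leqNgt -has_count; apply/hasPn=> -[x y] /lE /= nxy.
  rewrite /o /=; case: ifP => xy; apply: contra nuv => /eqP[<- <-] //.
  by rewrite /lt ltn_neqAle leqNgt [(_ < _)%N]xy andbT
    (inj_eq val_inj) (inj_eq enum_rank_inj) eq_sym.
rewrite oE [RHS]oE; apply: perm_big; apply/allP => -[u v] _ /=; apply/eqP.
by rewrite !cE //; case: ifP => // _; rewrite E12.
Qed.

Lemma edge_weight_iso (G1 G2 : lgraph k) (f : node k (unl G1) -> node k (unl G2)) :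
  bijective f -> (forall u v, mult D G2 (f u) (f v) = mult D G1 u v) ->
  forall psi, edge_weight (edges G1) (psi \o f) = edge_weight (edges G2) psi.
Proof.
move=> fb fm psi; have finj := bij_inj fb; rewrite -edge_weight_map.
apply: edge_weight_mult; rewrite ?map_edges_loopless ?loopless //.
by case: fb => g fK gK u v; rewrite -[u]gK -[v]gK mult_seq_map //; exact: esym (fm _ _).
Qed.

Definition precomp (V W : finType) (f : V -> W) (psi : {ffun W -> H}) :
  {ffun V -> H} := [ffun u => psi (f u)].

Lemma precomp_bij (V W : finType) (f : V -> W) :
  bijective f -> bijective (precomp f).
Proof.
case=> g fK gK; exists (precomp g) => psi; apply/ffunP=> u;
  by rewrite !ffunE ?fK ?gK.
Qed.

Lemma eq_edge_weight (V : Type) (E : seq (V * V)) (psi1 psi2 : V -> H) :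
  psi1 =1 psi2 -> edge_weight E psi1 = edge_weight E psi2.
Proof. by move=> e12; apply: eq_bigr => e _; rewrite !e12. Qed.

Lemma hom_graph_iso (G1 G2 : lgraph k) :
  iso D G1 G2 -> hom_graph G1 = hom_graph G2.
Proof.
case=> f [fb _ fm]; rewrite /hom_graph (reindex (precomp f)) /=; last first.
  exact/onW_bij/precomp_bij.
apply: eq_bigr => psi _; congr (_ * _).
  rewrite [RHS](reindex f) /=; last exact: onW_bij.
  by apply: eq_bigr => u _; rewrite ffunE.
rewrite -(edge_weight_iso fb fm); apply: eq_edge_weight => u.
by rewrite ffunE.
Qed.

Lemma hom_lab_graph_iso (G1 G2 : lgraph k) (phi : {ffun 'I_k -> H}) :
  iso D G1 G2 -> hom_lab_graph phi G1 = hom_lab_graph phi G2.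
Proof.
case=> f [fb fl fm]; rewrite /hom_lab_graph (reindex (precomp f)) /=; last first.
  exact/onW_bij/precomp_bij.
apply: eq_big => psi; first by apply: eq_forallb => i; rewrite ffunE fl.
move=> _; congr (_ * _); last first.
  rewrite -(edge_weight_iso fb fm); apply: eq_edge_weight => u.
  by rewrite ffunE.
pose p m (u : node k m) := if u is inr _ then true else false.
have inrE (m : nat) (a : node k m -> F) :
    \prod_(u < m) a (inr u) = \prod_(u | p m u) a u.
  rewrite [RHS](reindex_omap (inr : 'I_m -> node k m)
    (fun u => if u is inr b then Some b else None)) //=; last by case.
  by apply: eq_bigl => u; rewrite eqxx.
rewrite (inrE _ (fun u => alpha (precomp f psi u))).
rewrite (inrE _ (fun u => alpha (psi u))) [RHS](reindex f) /=; last exact: onW_bij.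
apply: eq_big => u; last by rewrite ffunE.
case: u => [i|a] /=; first by rewrite fl.
case E: (f (inr a)) => [i|//].
by have := bij_inj fb (etrans E (esym (fl i))).
Qed.

(* Both numbers depend only on the isomorphism class, by hom_graph_iso and
   hom_lab_graph_iso. *)
Definition hom_lab (phi : {ffun 'I_k -> H}) (G : PLG D k) : F :=
  hom_lab_graph phi (repr G).
Definition whom (G : PLG D k) : F := hom_graph (repr G).

Lemma hom_labE phi (G : lgraph k) :
  hom_lab phi (\pi_(PLG D k) G) = hom_lab_graph phi G.
Proof. exact/hom_lab_graph_iso/repr_pi_iso. Qed.

Lemma whomE (G : lgraph k) : whom (\pi_(PLG D k) G) = hom_graph G.
Proof. exact/hom_graph_iso/repr_pi_iso. Qed.

End Homomorphisms.

(* For a commutative monoid K and f : K -> F, the quotient of the monoid algebra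
   of K over F by the kernel of the bilinear form (x, y) |-> f(xy). *)
Section QuotientAlgebra.
Variables (F : fieldType) (K : conomType) (f : K -> F).

Local Notation A := {malg F[K]}.

Definition lin_ext (x : A) : F := \sum_(G <- msupp x) x@_G * f G.

Lemma lin_extE x : lin_ext x = mmap idfun f x.
Proof. by []. Qed.

Lemma lin_extZ c x : lin_ext (c *: x) = c * lin_ext x.
Proof.
rewrite lin_extE (mmapEw (msuppZ_le _ _)) big_distrr /=.
by apply: eq_bigr => G _; rewrite mcoeffZ mulrA.
Qed.

Lemma lin_extP c x y : lin_ext (c *: x + y) = c * lin_ext x + lin_ext y.
Proof. by rewrite -lin_extZ !lin_extE mmapD. Qed.

Definition fker (x : A) : bool := `[< forall y, lin_ext (x * y) = 0 >].

Lemma fker_lin c x y : fker x -> fker y -> fker (c *: x + y).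
Proof.
move=> /asboolP x0 /asboolP y0; apply/asboolP=> z.
by rewrite mulrDl -scalerAl lin_extP x0 y0 mulr0 addr0.
Qed.

Lemma fker0 : fker 0.
Proof. by apply/asboolP=> y; rewrite mul0r lin_extE mmap0. Qed.

Fact fker_zmod : zmod_closed fker.
Proof.
split=> [|x y kx ky]; first exact: fker0.
by rewrite addrC -scaleN1r; apply: fker_lin.
Qed.

HB.instance Definition _ := GRing.isZmodClosed.Build A fker fker_zmod.

Lemma fkerM x y : fker x -> fker (x * y).
Proof. by move=> /asboolP x0; apply/asboolP=> z; rewrite -mulrA x0. Qed.

Lemma fkerZ c x : fker x -> fker (c *: x).
Proof. by move=> kx; have := fker_lin c kx fker0; rewrite addr0. Qed.

(* The library quotients rings by proper ideals only, whereas fker may be the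
   whole algebra (when f = 0); hence the ring structure is put here on the
   quotient by the additive subgroup fker. *)
Definition fker_zmodClosed := GRing.ZmodClosed.clone A fker _.
Definition fquot := Quotient.quot fker_zmodClosed.

HB.instance Definition _ := GRing.Zmodule.on fquot.
HB.instance Definition _ : EqQuotient A (Quotient.equiv fker_zmodClosed) fquot :=
  EqQuotient.on fquot.

Definition fq_proj (x : A) : fquot := \pi_fquot x.
Definition fq_one : fquot := fq_proj 1.
Definition fq_mul (a b : fquot) : fquot := fq_proj (repr a * repr b).
Definition fq_scale (c : F) (a : fquot) : fquot := fq_proj (c *: repr a).

Lemma fq_eqP x y : fq_proj x = fq_proj y <-> fker (x - y).
Proof. by split=> [/eqP|kxy]; [|apply/eqP]; rewrite /fq_proj piE. Qed.

Lemma fq_projK a : fq_proj (repr a) = a.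
Proof. exact: reprK. Qed.

Lemma fq_projD x y : fq_proj (x + y) = fq_proj x + fq_proj y.
Proof. exact: pi_addr. Qed.

Lemma fq_reprB x : fker (repr (fq_proj x) - x).
Proof. by apply/fq_eqP; rewrite fq_projK. Qed.

Lemma fq_projM x y : fq_proj (x * y) = fq_mul (fq_proj x) (fq_proj y).
Proof.
apply/esym/fq_eqP; set x' := repr _; set y' := repr _.
have -> : x' * y' - x * y = 1 *: ((x' - x) * y') + (y' - y) * x.
  by rewrite scale1r !mulrBl [y' * x]mulrC [y * x]mulrC addrA subrK.
by apply: fker_lin; apply: fkerM; apply: fq_reprB.
Qed.

Lemma fq_projZ c x : fq_proj (c *: x) = fq_scale c (fq_proj x).
Proof.
by apply/esym/fq_eqP; rewrite -scalerBr; apply/fkerZ/fq_reprB.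
Qed.

Fact fq_mulA : associative fq_mul.
Proof.
move=> a b c; rewrite -[a]fq_projK -[b]fq_projK -[c]fq_projK.
by move: (repr a) (repr b) (repr c) => x y z; rewrite -!fq_projM mulrA.
Qed.

Fact fq_mulC : commutative fq_mul.
Proof. by move=> a b; rewrite /fq_mul mulrC. Qed.

Fact fq_mul1 : left_id fq_one fq_mul.
Proof. by move=> a; rewrite -[a]fq_projK -fq_projM mul1r. Qed.

Fact fq_mulDl : left_distributive fq_mul +%R.
Proof.
move=> a b c; rewrite -[a]fq_projK -[b]fq_projK -[c]fq_projK.
move: (repr a) (repr b) (repr c) => x y z.
by rewrite -fq_projD -!fq_projM -fq_projD mulrDl.
Qed.

HB.instance Definition _ := GRing.Zmodule_isComPzRing.Build fquot
  fq_mulA fq_mulC fq_mul1 fq_mulDl.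

Fact fq_scaleA c1 c2 a : fq_scale c1 (fq_scale c2 a) = fq_scale (c1 * c2) a.
Proof. by rewrite -[a]fq_projK -!fq_projZ scalerA. Qed.

Fact fq_scale1 : left_id 1 fq_scale.
Proof. by move=> a; rewrite -[a]fq_projK -fq_projZ scale1r. Qed.

Fact fq_scaleDr : right_distributive fq_scale +%R.
Proof.
move=> c a b; rewrite -[a]fq_projK -[b]fq_projK.
move: (repr a) (repr b) => x y.
by rewrite -fq_projD -!fq_projZ -fq_projD scalerDr.
Qed.

Fact fq_scaleDl a : {morph fq_scale^~ a : c1 c2 / c1 + c2}.
Proof.
move=> c1 c2; rewrite -[a]fq_projK; move: (repr a) => x.
by rewrite -!fq_projZ -fq_projD scalerDl.
Qed.

HB.instance Definition _ := GRing.Zmodule_isLmodule.Build F fquot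
  fq_scaleA fq_scale1 fq_scaleDr fq_scaleDl.

End QuotientAlgebra.

Section GraphAlgebra.
Variables (F : fieldType) (H : wgraph F) (k : nat).

Definition gquot := fquot (@whom F H k).

HB.instance Definition _ := GRing.ComPzRing.on gquot.
HB.instance Definition _ := GRing.Lmodule.on gquot.

(* F^r is {ffun 'I_r -> F^o}, whose ring and module operations are
   componentwise. *)
Definition gquot_alg_iso (r : nat) : Prop :=
  exists f : gquot -> {ffun 'I_r -> F^o},
    [/\ bijective f, linear f & monoid_morphism f].

End GraphAlgebra.

Section Ranks.
Variable F : fieldType.

Definition has_dim (V : lmodType F) (S : V -> Prop) (r : nat) : Prop :=
  exists b : 'I_r -> V,
    [/\ forall i, S (b i),
        forall c : 'I_r -> F, \sum_i c i *: b i = 0 -> forall i, c i = 0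
      & forall v, S v -> exists c : 'I_r -> F, v = \sum_i c i *: b i].

Definition row_space (I J : Type) (A : I -> J -> F) (v : J -> F^o) : Prop :=
  exists (m : nat) (i : 'I_m -> I) (c : 'I_m -> F),
    v = \sum_l c l *: (A (i l) : J -> F^o).

Definition has_rank (I J : Type) (A : I -> J -> F) (r : nat) : Prop :=
  has_dim (row_space A) r.

Definition is_least (P : nat -> Prop) (r : nat) : Prop :=
  P r /\ forall s, P s -> (r <= s)%N.

Definition tensor_decomp (X : Type) n (T : ('I_n -> X) -> F) (r : nat) : Prop :=
  exists (a : 'I_r -> F) (f : 'I_r -> 'I_n -> X -> F),
    forall x, T x = \sum_i a i * \prod_j f i j (x j).

Definition sym_tensor_decomp (X : Type) n (T : ('I_n -> X) -> F) (r : nat) : Prop :=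
  exists (a : 'I_r -> F) (f : 'I_r -> X -> F),
    forall x, T x = \sum_i a i * \prod_j f i (x j).

Definition has_tensor_rank (X : Type) n (T : ('I_n -> X) -> F) :=
  is_least (tensor_decomp T).

Definition has_sym_rank (X : Type) n (T : ('I_n -> X) -> F) :=
  is_least (sym_tensor_decomp T).

End Ranks.

Section Connection.
Variables (F : fieldType) (H : wgraph F) (k : nat).
Local Notation X := (PLG (directed H) k).

Definition conn_tensor n (G : 'I_n -> X) : F :=
  whom (\big[@plg_mul (directed H) k/plg_one (directed H) k]_(j < n) G j).

Definition conn_matrix (G1 G2 : X) : F := conn_tensor (tnth [tuple G1; G2]).

Definition hom_matrix (phi : {ffun 'I_k -> H}) (G : X) : F := hom_lab phi G.

End Connection.

(* Main.v *)
(* The number f_H(G) is the sum over phi of w(phi) hom_phi(G), where w(phi) is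
   the product of the alpha(phi(i)), and each hom_phi is a character of the
   monoid of k-labeled graphs. A linear combination of r distinct characters with
   nonzero coefficients has r for all the ranks in question, because interpolation
   produces elements of the monoid algebra dual to the characters. As w is
   constant and nonzero on orbits of Aut(H) and F has characteristic 0, it remains
   to see that hom_phi = hom_psi forces psi to be in the orbit of phi.

   If phi hits every vertex at least three times, single edges and twin-freeness
   yield a beta-preserving permutation s with psi = s phi. It preserves alpha too:
   unlabeling the (k+1)st node gives an equality between combinations of the
   characters hom_(phi,v) and hom_(psi,v), in which hom_(phi,v) has coefficient
   alpha(v) and can only be matched by hom_(psi,s(v)), of coefficient alpha(s(v)).
   In general, extend phi by labels nu that make it hit every vertex three times
   and unlabel: the extensions of phi with the same character as (phi,nu) lie in
   its orbit, so their weights add up to a nonzero multiple of w(nu), and some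
   extension of psi must have that same character. *)
From HB Require Import structures.
Require Import Defs.
From mathcomp Require Import all_boot all_order all_fingroup all_algebra.
From mathcomp Require Import generic_quotient finmap boolp functions monalg.

Set Implicit Arguments.
Unset Strict Implicit.
Unset Printing Implicit Defensive.

Import GRing.Theory.
Local Open Scope ring_scope.

(** * Characters of a commutative monoid, and the ranks of their linear combinations *)

Section Characters.
Variables (F : fieldType) (K : conomType).
Local Notation A := {malg F[K]}.
Local Notation ev chi := (mmap (@idfun F) (chi : K -> F)).

Lemma eq_mmap (f g : K -> F) (x : A) : f =1 g -> ev f x = ev g x.
Proof. by move=> fg; apply: eq_bigr => G _; rewrite fg. Qed.

Lemma mmap_lincomb (I : finType) (a : I -> F) (u : I -> K -> F) (x : A) :
  ev (fun g => \sum_i a i * u i g) x = \sum_i a i * ev (u i) x.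
Proof.
under [RHS]eq_bigr do rewrite mmapE big_distrr /=.
rewrite exchange_big mmapE /=; apply: eq_bigr => G _.
by rewrite big_distrr; apply: eq_bigr => i _ /=; rewrite mulrCA.
Qed.

(* Interpolation: multiply the elements [(g - chi j g) / (chi i g - chi j g)],
   one for each [j] and some [g] on which [chi i] and [chi j] differ. *)
Lemma separating_element (I : finType) (chi : I -> {mmorphism K -> F}) (i : I) :
  exists x : A, forall j, ev (chi j) x = (`[< chi j =1 chi i >])%:R.
Proof.
have Y j : exists y : A,
    ev (chi i) y = 1 /\ (~ (chi j =1 chi i) -> ev (chi j) y = 0).
  case: (pselect (chi j =1 chi i)) => [ij|nij].
    by exists 1; split=> //; exact: mmap1.
  have [g gP] : exists g, chi j g <> chi i g by apply/existsNP.
  pose d := chi i g - chi j g.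
  have dN0 : d != 0 by rewrite subr_eq0; apply/eqP => /esym.
  exists (d^-1 *: (<< g >> - (chi j g)%:MP)); split=> [|_].
    by rewrite linearZ linearB /= mmapU mmapC mul1r mulVf.
  by rewrite linearZ linearB /= mmapU mmapC mul1r subrr mulr0.
have [y yP] := choice Y.
exists (\prod_j y j) => j; rewrite rmorph_prod /=.
case: asboolP => [ji|nji].
  by rewrite big1 // => l _; rewrite (eq_mmap _ ji); case: (yP l).
by rewrite (bigD1 j) //= (proj2 (yP j)) ?mul0r.
Qed.

Section CharacterSums.
Variables (r : nat) (chi : 'I_r -> {mmorphism K -> F}) (c : 'I_r -> F).
Variable f : K -> F.
Hypothesis chi_inj : forall i j, chi i =1 chi j -> i = j.
Hypothesis cN0 : forall i, c i != 0.
Hypothesis fE : forall g, f g = \sum_i c i * chi i g.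

Lemma dual_elements :
  exists x : 'I_r -> A, forall i j, ev (chi j) (x i) = (i == j)%:R.
Proof.
have [x xP] := choice (separating_element chi).
exists x => i j; rewrite xP; congr (nat_of_bool _)%:R.
by apply/asboolP/eqP => [/chi_inj/esym//|->].
Qed.

Lemma mmap_dual_comb (x : 'I_r -> A) :
  (forall i j, ev (chi j) (x i) = (i == j)%:R) ->
  forall (v : 'I_r -> F) i, ev (chi i) (\sum_j v j *: x j) = v i.
Proof.
move=> xP v i; rewrite linear_sum (bigD1 i) //= big1 => [|j /negPf ji].
  by rewrite linearZ /= xP eqxx mulr1 addr0.
by rewrite linearZ /= xP ji mulr0.
Qed.

Lemma mmap_sum (x : A) : ev f x = \sum_i c i * ev (chi i) x.
Proof. by rewrite -mmap_lincomb; apply: eq_mmap. Qed.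

(** Pairing [x] with the dual element of [chi i] isolates [c i] times the value of [chi i] at [x],
    and [c i] is nonzero. *)
Lemma fkerE (x : A) : fker f x <-> forall i, ev (chi i) x = 0.
Proof.
split=> [/asboolP x0 i|x0].
  have [y yP] := dual_elements; have := x0 (y i).
  rewrite lin_extE mmap_sum (bigD1 i) //= big1 => [|j ji]; last first.
    by rewrite rmorphM /= yP eq_sym (negPf ji) !mulr0.
  rewrite addr0 rmorphM /= yP eqxx mulr1 => /eqP.
  by rewrite mulf_eq0 (negPf (cN0 i)) => /eqP.
apply/asboolP => y; rewrite lin_extE mmap_sum big1 // => i _.
by rewrite rmorphM /= x0 mul0r mulr0.
Qed.

(** The choice of representative is harmless: every [chi i] vanishes on [fker f]. *)
Definition fq_eval (a : fquot f) : {ffun 'I_r -> F^o} :=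
  [ffun i => ev (chi i) (repr a)].

Lemma fq_evalE x : fq_eval (fq_proj f x) = [ffun i => ev (chi i) x].
Proof.
apply/ffunP => i; rewrite !ffunE; apply/eqP; rewrite -subr_eq0 -linearB.
by apply/eqP; have /fkerE := fq_reprB f x; apply.
Qed.

Lemma fq_eval_bij : bijective fq_eval.
Proof.
have [x xP] := dual_elements.
have ev_comb := mmap_dual_comb xP.
(* The dual elements realize any prescribed vector of values, which gives the inverse map. *)
exists (fun v : {ffun 'I_r -> F^o} => fq_proj f (\sum_i (v i : F) *: x i)) => [a|v].
  rewrite -[RHS]fq_projK; apply/fq_eqP/fkerE => i.
  by rewrite linearB /= ev_comb ffunE subrr.
by rewrite fq_evalE; apply/ffunP => i; rewrite ffunE ev_comb.
Qed.

Lemma fq_eval_linear : linear fq_eval.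
Proof.
move=> t a b; rewrite -[a]fq_projK -[b]fq_projK.
move: (repr a) (repr b) => x y.
have -> : t *: fq_proj f x = fq_proj f (t *: x) by rewrite fq_projZ.
rewrite -fq_projD !fq_evalE; apply/ffunP => i.
by rewrite !ffunE linearP.
Qed.

Lemma fq_eval_monoid_morphism : monoid_morphism fq_eval.
Proof.
split.
  have -> : 1 = fq_proj f 1 by [].
  by rewrite fq_evalE; apply/ffunP => i; rewrite !ffunE rmorph1.
move=> a b; rewrite -[a]fq_projK -[b]fq_projK.
move: (repr a) (repr b) => x y.
have -> : fq_proj f x * fq_proj f y = fq_proj f (x * y) by rewrite fq_projM.
rewrite !fq_evalE; apply/ffunP => i.
by rewrite !ffunE rmorphM.
Qed.

Lemma characters_free (a : 'I_r -> F) :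
  (forall g, \sum_i a i * chi i g = 0) -> forall i, a i = 0.
Proof.
move=> a0 i; have [x xP] := dual_elements.
(* The vanishing combination, extended linearly to the monoid algebra, takes the value [a i] at the
   dual element [x i]. *)
have : ev (fun g => \sum_i a i * chi i g) (x i) = 0.
  by rewrite mmapE big1 // => g _; rewrite a0 mulr0.
rewrite mmap_lincomb (bigD1 i) //= big1 => [|j /negPf ji].
  by rewrite xP eqxx mulr1 addr0.
by rewrite xP eq_sym ji mulr0.
Qed.

Lemma has_dim_fquot : has_dim (fun _ : fquot f => True) r.
Proof.
have [x xP] := dual_elements.
have fq0 : fq_proj f 0 = 0.
  by apply: (addrI (fq_proj f 0)); rewrite -fq_projD !addr0.
have combE (a : 'I_r -> F) :
    \sum_i a i *: fq_proj f (x i) = fq_proj f (\sum_i a i *: x i).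
  rewrite (big_morph _ (fq_projD f) fq0).
  by apply: eq_bigr => i _; rewrite fq_projZ.
have ev_comb := mmap_dual_comb xP.
exists (fun i => fq_proj f (x i)); split=> // [a|v _].
  rewrite combE => a0 i.
  have /fkerE/(_ i) : fker f (\sum_i a i *: x i - 0) by apply/fq_eqP; rewrite fq0.
  by rewrite subr0 ev_comb.
exists (fun i => ev (chi i) (repr v)); rewrite combE -[LHS]fq_projK.
by apply/fq_eqP/fkerE => i; rewrite linearB /= ev_comb subrr.
Qed.

(** Extended linearly in both arguments and evaluated at dual elements, the identity factors an
    invertible diagonal matrix of size [r] through dimension [s]. *)
Lemma bilinear_rank_ge s (a : 'I_s -> F) (u v : 'I_s -> K -> F) :
  (forall g h, \sum_i c i * chi i g * chi i h = \sum_l a l * u l g * v l h) ->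
  (r <= s)%N.
Proof.
move=> E; have [x xP] := dual_elements.
(* The identity is extended linearly in [h] first, then in [g]. *)
have E1 g y : \sum_i c i * chi i g * ev (chi i) y =
              \sum_l a l * u l g * ev (v l) y.
  by rewrite -!mmap_lincomb; apply: eq_mmap.
have E2 y z : \sum_i (c i * ev (chi i) z) * ev (chi i) y =
              \sum_l (a l * ev (v l) z) * ev (u l) y.
  rewrite -!mmap_lincomb; apply: eq_mmap => g.
  under eq_bigr do rewrite mulrAC; under [RHS]eq_bigr do rewrite mulrAC.
  exact: E1.
pose U := \matrix_(i < r, l < s) ev (u l) (x i).
pose V := \matrix_(l < s, j < r) (a l * ev (v l) (x j)).
have dUV : diag_mx (\row_i c i) = U *m V.
  apply/matrixP => i j; rewrite !mxE.
  under eq_bigr do rewrite !mxE mulrC.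
  rewrite -E2 (bigD1 i) //= big1 => [|l /negPf li].
    by rewrite !xP eqxx mulr1 addr0 mulr_natr [j == i]eq_sym.
  by rewrite !xP [i == l]eq_sym li mulr0.
have : \rank (diag_mx (\row_i c i)) = r.
  apply/mxrank_unit; rewrite unitmxE det_diag unitfE.
  by apply/prodf_neq0 => i _; rewrite mxE.
move=> <-; rewrite dUV; apply: leq_trans (mxrankM_maxl _ _) _.
exact: rank_leq_col.
Qed.

Lemma sym_tensor_decomp_characters n :
  sym_tensor_decomp (fun g : 'I_n -> K => f (\big[mmul/mone]_j g j)) r.
Proof.
exists c, (fun i => chi i) => g; rewrite fE; apply: eq_bigr => i _.
by rewrite (big_morph _ (mmorphM (chi i)) (mmorph1 (chi i))).
Qed.

(** Freezing all arguments but the first two at the identity reduces to the bilinear bound. *)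
Lemma tensor_rank_ge n s : (2 <= n)%N ->
  tensor_decomp (fun g : 'I_n -> K => f (\big[mmul/mone]_j g j)) s -> (r <= s)%N.
Proof.
case: n => [|[|n]] // _ [a [u E]].
pose w l := \prod_(j < n) u l (lift ord0 (lift ord0 j)) mone.
apply: (@bilinear_rank_ge s (fun l => a l * w l) (fun l => u l ord0)
          (fun l => u l (lift ord0 ord0))) => g h.
pose t (j : 'I_n.+2) : K :=
  if val j is j'.+1 then if j' is _.+1 then mone else h else g.
have -> : \sum_i c i * chi i g * chi i h = f (\big[mmul/mone]_j t j).
  rewrite fE; apply: eq_bigr => i _; rewrite !big_ord_recl /= big1 //.
  by rewrite mulm1 mmorphM mulrA.
rewrite E; apply: eq_bigr => l _; rewrite !big_ord_recl /=.
by rewrite -/(w l) -!mulrA; congr (_ * _); rewrite [RHS]mulrC -mulrA.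
Qed.

Lemma has_tensor_rank_characters n : (2 <= n)%N ->
  has_tensor_rank (fun g : 'I_n -> K => f (\big[mmul/mone]_j g j)) r.
Proof.
move=> n_ge2; split=> [|s]; last exact: tensor_rank_ge.
have [a [u E]] := sym_tensor_decomp_characters n.
by exists a, (fun i _ => u i).
Qed.

Lemma has_sym_rank_characters n : (2 <= n)%N ->
  has_sym_rank (fun g : 'I_n -> K => f (\big[mmul/mone]_j g j)) r.
Proof.
move=> n_ge2; split=> [|s [a [u E]]]; first exact: sym_tensor_decomp_characters.
by apply: (tensor_rank_ge n_ge2); exists a, (fun i _ => u i).
Qed.

(** The characters form a basis of the row space: row [g] has coordinates [c i * chi i g]. *)
Lemma has_rank_mul : has_rank (fun g h : K => f (mmul g h)) r.
Proof.
have [x xP] := dual_elements.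
have rowE g h : f (mmul g h) = \sum_i c i * chi i h * chi i g.
  by rewrite fE; apply: eq_bigr => i _; rewrite mmorphM mulrA mulrAC.
exists (fun i => chi i : K -> F^o); split.
(* The rows indexed by the support of [x i], weighted by its coefficients divided by [c i], add up
   to [chi i]. *)
- move=> i; exists (size (msupp (x i))).
  exists (tnth (in_tuple (msupp (x i)))).
  exists (fun l => (c i)^-1 * (x i)@_(tnth (in_tuple (msupp (x i))) l)).
  apply/funext => h; rewrite fct_sumE.
  have -> : chi i h = (c i)^-1 * ev (fun g => f (mmul g h)) (x i).
    rewrite (eq_mmap _ (rowE^~ h)) mmap_lincomb (bigD1 i) //=.
    rewrite big1 => [|j /negPf ji]; last by rewrite xP eq_sym ji mulr0.
    by rewrite xP eqxx addr0 mulr1 mulKf.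
  rewrite mmapE big_distrr big_tnth; apply: eq_bigr => l _.
  by rewrite /= mulrA.
- move=> a a0; apply: characters_free => g.
  by have /(congr1 (@^~ g)) := a0; rewrite fct_sumE.
- move=> v [m [g [a ->]]].
  exists (fun i => \sum_l a l * (c i * chi i (g l))).
  apply/funext => h; rewrite !fct_sumE.
  transitivity (\sum_l \sum_i a l * (c i * chi i (g l)) * chi i h).
    apply: eq_bigr => l _; rewrite -[LHS]/(a l * f _) rowE big_distrr.
    by apply: eq_bigr => i _; rewrite /= -!mulrA [chi i h * _]mulrC.
  rewrite exchange_big; apply: eq_bigr => i _.
  by rewrite -[RHS]/(_ * chi i h) big_distrl.
Qed.

Lemma has_rank_rows (I : Type) (psi : I -> K -> F) :
  (forall i, exists p, chi i =1 psi p) -> (forall p, exists i, psi p =1 chi i) ->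
  has_rank psi r.
Proof.
move=> /choice[p pP] /choice[q qP].
exists (fun i => chi i : K -> F^o); split.
- move=> i; exists 1%N, (fun _ => p i), (fun _ => 1).
  by rewrite big_ord1 scale1r; apply/funext => g; apply: pP.
- move=> a a0; apply: characters_free => g.
  by have /(congr1 (@^~ g)) := a0; rewrite fct_sumE.
- move=> v [m [t [a ->]]].
  (* Rows equal to the same character have their coefficients added. *)
  exists (fun i => \sum_(l | q (t l) == i) a l).
  apply/funext => h; rewrite !fct_sumE.
  rewrite (partition_big (fun l => q (t l)) predT) //=.
  apply: eq_bigr => i _; rewrite -[RHS]/(_ * chi i h) big_distrl /=.
  by apply: eq_bigr => l /eqP <-; rewrite -[LHS]/(a l * psi (t l) h) qP.
Qed.

End CharacterSums.
End Characters.

(** * Concatenation of finite maps *)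

Section CatFfun.
Variables (T : finType) (m n : nat).

Definition cat_ffun (f : {ffun 'I_m -> T}) (g : {ffun 'I_n -> T}) :
    {ffun 'I_(m + n) -> T} :=
  [ffun a => match fintype.split a with inl i => f i | inr j => g j end].

Lemma cat_ffun_l f g i : cat_ffun f g (lshift n i) = f i.
Proof. by rewrite ffunE (unsplitK (inl i)). Qed.

Lemma cat_ffun_r f g j : cat_ffun f g (rshift m j) = g j.
Proof. by rewrite ffunE (unsplitK (inr j)). Qed.

Lemma sum_cat_ffun (R : nmodType) (h : {ffun 'I_(m + n) -> T} -> R) :
  \sum_f h f = \sum_f1 \sum_f2 h (cat_ffun f1 f2).
Proof.
rewrite pair_big /= (reindex (fun p => cat_ffun p.1 p.2)) //=.
exists (fun f : {ffun 'I_(m + n) -> T} =>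
  ([ffun i => f (lshift n i)], [ffun j => f (rshift m j)])) => [[f1 f2]|f] _ /=.
  by congr (_, _); apply/ffunP => i; rewrite ffunE ?cat_ffun_l ?cat_ffun_r.
apply/ffunP => a; case: (split_ordP a) => b ->.
  by rewrite cat_ffun_l ffunE.
by rewrite cat_ffun_r ffunE.
Qed.

End CatFfun.

(** * Labeled homomorphism numbers as characters *)

Section LabeledHomomorphisms.
Variables (F : fieldType) (H : wgraph F).
Local Notation D := (directed H).

Definition node_ext k m (phi : {ffun 'I_k -> H}) (mu : {ffun 'I_m -> H})
    (u : node k m) : H :=
  match u with inl i => phi i | inr a => mu a end.

Definition map_weight m (mu : {ffun 'I_m -> H}) : F := \prod_u alpha (mu u).

Lemma map_weight_neq0 m (mu : {ffun 'I_m -> H}) : map_weight mu != 0.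
Proof. by apply/prodf_neq0 => i _; apply: alpha_neq0. Qed.

Lemma map_weight_cat m n (mu : {ffun 'I_m -> H}) (nu : {ffun 'I_n -> H}) :
  map_weight (cat_ffun mu nu) = map_weight mu * map_weight nu.
Proof.
rewrite /map_weight big_split_ord /=; congr (_ * _); apply: eq_bigr => i _.
  by rewrite cat_ffun_l.
by rewrite cat_ffun_r.
Qed.

Lemma hom_lab_graphE k (phi : {ffun 'I_k -> H}) (G : lgraph k) :
  hom_lab_graph phi G =
  \sum_mu map_weight mu * edge_weight (edges G) (node_ext phi mu).
Proof.
rewrite /hom_lab_graph.
rewrite (reindex_onto (fun mu => [ffun u => node_ext phi mu u])
  (fun psi : {ffun node k (unl G) -> H} => [ffun a => psi (inr a)])) /=.
  apply: eq_big => [mu|mu _].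
    apply/andP; split; first by apply/forallP => i; rewrite ffunE.
    by apply/eqP/ffunP => a; rewrite !ffunE.
  congr (_ * _); first by apply: eq_bigr => u _; rewrite ffunE.
  by apply: eq_edge_weight => u; rewrite ffunE.
move=> psi /forallP psiP; apply/ffunP => -[i|a]; rewrite ffunE /=.
  by rewrite (eqP (psiP i)).
by rewrite ffunE.
Qed.

(** The unlabeled nodes of a product are a disjoint union, so the sum over their images splits into
    a product of two sums. *)
Lemma hom_lab_graphM k (phi : {ffun 'I_k -> H}) (G1 G2 : lgraph k) :
  hom_lab_graph phi (gmul G1 G2) = hom_lab_graph phi G1 * hom_lab_graph phi G2.
Proof.
rewrite !hom_lab_graphE big_distrlr /= sum_cat_ffun.
apply: eq_bigr => mu _; apply: eq_bigr => nu _.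
rewrite map_weight_cat -!mulrA; congr (_ * _); rewrite mulrCA; congr (_ * _).
rewrite /edges /= {1}/edge_weight big_cat -!/(edge_weight _ _).
by congr (_ * _); rewrite [LHS]edge_weight_map; apply: eq_edge_weight => -[i|a] //=;
  rewrite ?cat_ffun_l ?cat_ffun_r.
Qed.

Lemma hom_lab_gone k (phi : {ffun 'I_k -> H}) : hom_lab_graph phi (gone k) = 1.
Proof.
rewrite hom_lab_graphE (eq_bigr (fun _ => 1)) => [|mu _].
  by rewrite sumr_const card_ffun card_ord expn0.
by rewrite /map_weight big_ord0 mul1r /edge_weight big_nil.
Qed.

Fact hom_lab_mmorphism k (phi : {ffun 'I_k -> H}) : mmorphism (@hom_lab F H k phi).
Proof.
split=> [x y|]; last by rewrite hom_labE hom_lab_gone.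
by rewrite [LHS]hom_labE hom_lab_graphM.
Qed.

HB.instance Definition _ k (phi : {ffun 'I_k -> H}) :=
  monalg.isMultiplicative.Build (PLG D k) F (@hom_lab F H k phi)
    (hom_lab_mmorphism phi).

(** The maps are sorted by their restriction to the labeled nodes, whose vertex weights make up
    [map_weight phi]. *)
Lemma hom_graphE k (G : lgraph k) :
  hom_graph H G = \sum_(phi : {ffun 'I_k -> H}) map_weight phi * hom_lab_graph phi G.
Proof.
rewrite /hom_graph.
rewrite (partition_big (fun psi : {ffun node k (unl G) -> H} =>
  [ffun i => psi (inl i)] : {ffun 'I_k -> H}) predT) //=.
apply: eq_bigr => phi _; rewrite /hom_lab_graph big_distrr /=.
apply: eq_big => psi.
  apply/eqP/forallP => [<- i|psiP]; first by rewrite ffunE.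
  by apply/ffunP => i; rewrite ffunE (eqP (psiP i)).
move=> /eqP <-; rewrite mulrA; congr (_ * _); rewrite big_sumType /=.
by congr (_ * _); apply: eq_bigr => i _; rewrite ffunE.
Qed.

Lemma whom_sum k (G : PLG D k) :
  whom G = \sum_(phi : {ffun 'I_k -> H}) map_weight phi * hom_lab phi G.
Proof. exact: hom_graphE. Qed.

(** * Removing labels *)

Definition unlabel_node k l m (u : node (k + l) m) : node k (l + m) :=
  match u with
  | inl a => match fintype.split a with
             | inl i => inl i
             | inr j => inr (lshift m j)
             end
  | inr b => inr (rshift l b)
  end.

Lemma unlabel_node_inj k l m : injective (@unlabel_node k l m).
Proof.
pose g (u : node k (l + m)) : node (k + l) m :=
  match u with
  | inl i => inl (lshift l i)
  | inr a => match fintype.split a with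
             | inl j => inl (rshift k j)
             | inr b => inr b
             end
  end.
apply: (can_inj (g := g)) => -[a|b] /=; last by rewrite (unsplitK (inr b)).
by case: (split_ordP a) => i -> //=; rewrite (unsplitK (inl i)).
Qed.

Fact unlabel_loopless k l (G : lgraph (k + l)) :
  all (fun e => e.1 != e.2) (tagged (Tagged (fun m => seq (node k m * node k m))
    (map_edges (@unlabel_node k l (unl G)) (edges G)))).
Proof. by rewrite map_edges_loopless ?loopless //; exact: unlabel_node_inj. Qed.

Definition unlabel k l (G : lgraph (k + l)) : lgraph k :=
  LGraph (unlabel_loopless G).

(** A freed node ranges over all of [H] and now carries its vertex weight. Freed nodes precede the
    old unlabeled ones, which matches the splitting by [sum_cat_ffun]. *)
Lemma hom_lab_unlabel k l (phi : {ffun 'I_k -> H}) (G : lgraph (k + l)) :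
  hom_lab_graph phi (unlabel G) =
  \sum_(nu : {ffun 'I_l -> H}) map_weight nu * hom_lab_graph (cat_ffun phi nu) G.
Proof.
rewrite hom_lab_graphE sum_cat_ffun; apply: eq_bigr => nu _.
rewrite hom_lab_graphE big_distrr /=; apply: eq_bigr => mu _.
rewrite map_weight_cat -mulrA; congr (_ * (_ * _)).
rewrite [LHS]edge_weight_map; apply: eq_edge_weight => -[a|b] /=.
  by rewrite [RHS]ffunE; case: (fintype.split a) => // j; rewrite /= cat_ffun_l.
by rewrite cat_ffun_r.
Qed.

(** Unlabeling turns the hypothesis into an equality of two combinations of characters of
    [(k + l)]-labeled graphs; an element separating the character of [Phi] reads off its total
    coefficient on each side. *)
Lemma class_weight_eq k l (phi psi : {ffun 'I_k -> H})
    (Phi : {ffun 'I_(k + l) -> H}) :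
  hom_lab phi =1 hom_lab psi ->
  \sum_(nu | `[< hom_lab (cat_ffun phi nu) =1 hom_lab Phi >]) map_weight nu =
  \sum_(nu | `[< hom_lab (cat_ffun psi nu) =1 hom_lab Phi >]) map_weight nu.
Proof.
move=> e.
have e' (G : PLG D (k + l)) :
    \sum_(nu : {ffun 'I_l -> H}) map_weight nu * hom_lab (cat_ffun phi nu) G =
    \sum_(nu : {ffun 'I_l -> H}) map_weight nu * hom_lab (cat_ffun psi nu) G.
  by rewrite /hom_lab -!hom_lab_unlabel -!(hom_labE _ (unlabel _)).
have [x xP] := separating_element
  (fun Psi : {ffun 'I_(k + l) -> H} => @hom_lab F H (k + l) Psi) Phi.
have sumE (p : {ffun 'I_k -> H}) :
    \sum_(nu | `[< hom_lab (cat_ffun p nu) =1 hom_lab Phi >]) map_weight nu =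
    mmap idfun (fun G => \sum_(nu : {ffun 'I_l -> H})
       map_weight nu * hom_lab (cat_ffun p nu) G) x.
  rewrite mmap_lincomb big_mkcond; apply: eq_bigr => nu _; rewrite xP.
  by case: asboolP => _; rewrite ?mulr1 ?mulr0.
by rewrite !sumE; apply: eq_mmap.
Qed.

(** * Automorphisms and equality of characters *)

Lemma hom_lab_wAut k (phi : {ffun 'I_k -> H}) (s : {perm H}) :
  s \in wAut H -> hom_lab (post_comp phi s) =1 hom_lab phi.
Proof.
move=> /wAutP[sa sb] G; rewrite /hom_lab !hom_lab_graphE.
rewrite (reindex (fun mu => post_comp mu s)) /=; last first.
  exists (fun mu => post_comp mu s^-1%g) => mu _; apply/ffunP => i;
    by rewrite !ffunE ?permK ?permKV.
apply: eq_bigr => mu _; congr (_ * _).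
  by apply: eq_bigr => u _; rewrite ffunE sa.
apply: eq_bigr => e _; rewrite -[RHS]sb; congr beta.
  by case: e.1 => i /=; rewrite ffunE.
by case: e.2 => i /=; rewrite ffunE.
Qed.

Definition edge_graph k (i j : 'I_k) (ij : i != j) : lgraph k :=
  @LGraph k (Tagged (fun m => seq (node k m * node k m))
    [:: (inl i, inl j) : node k 0 * node k 0])
    (introT andP (conj (ij : inl i != inl j :> node k 0) isT)).

Lemma hom_lab_edge k (phi : {ffun 'I_k -> H}) (i j : 'I_k) (ij : i != j) :
  hom_lab_graph phi (edge_graph ij) = beta (phi i) (phi j).
Proof.
rewrite hom_lab_graphE (eq_bigr (fun _ => beta (phi i) (phi j))) => [|mu _].
  by rewrite sumr_const card_ffun card_ord expn0.
by rewrite /map_weight big_ord0 mul1r /edge_weight /edges /= big_seq1.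
Qed.

Lemma hom_lab_eq_beta k (phi psi : {ffun 'I_k -> H}) (i j : 'I_k) :
  hom_lab phi =1 hom_lab psi -> i != j ->
  beta (phi i) (phi j) = beta (psi i) (psi j).
Proof. by move=> e ij; rewrite -!(hom_lab_edge _ ij) -!hom_labE. Qed.

(* At least three preimages: besides the two labels to be compared, there has to
   be a third one, since graphs have no loops. *)
Definition thick k (phi : {ffun 'I_k -> H}) : Prop :=
  forall (v : H) (s : seq 'I_k), (size s <= 2)%N ->
    exists2 i, i \notin s & phi i = v.

Lemma thick_cat k l (phi : {ffun 'I_k -> H}) (nu : {ffun 'I_l -> H}) :
  thick phi -> thick (cat_ffun phi nu).
Proof.
move=> phiT v s sz.
pose p (a : 'I_(k + l)) := if fintype.split a is inl b then Some b else None.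
have pK b : p (lshift l b) = Some b by rewrite /p (unsplitK (inl b)).
have [b bP <-] : exists2 b, b \notin pmap p s & phi b = v.
  by apply: phiT; rewrite size_pmap (leq_trans (count_size _ _)).
exists (lshift l b); last by rewrite cat_ffun_l.
by apply: contra bP => /(map_f p); rewrite mem_pmap pK.
Qed.

Lemma thick_extension :
  exists (l : nat) (nu : {ffun 'I_l -> H}),
    forall k (phi : {ffun 'I_k -> H}), thick (cat_ffun phi nu).
Proof.
(* Three new labels for every vertex: a list of at most two labels misses one of them. *)
pose T := (H * 'I_3)%type.
exists #|{: T}|, [ffun a => (enum_val a).1] => k phi v s sz.
pose g (t : 'I_3) := rshift k (enum_rank ((v, t) : T)).
have ginj : injective g by move=> t t' /rshift_inj/enum_rank_inj [].
have [t tP] : exists t, g t \notin s.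
  apply/existsP; rewrite -negb_forall; apply/negP => /forallP gP.
  have : (size (codom g) <= size s)%N.
    apply: uniq_leq_size; first exact/injectiveP.
    by move=> _ /codomP[t ->].
  by rewrite size_codom card_ord => /leq_trans/(_ sz).
by exists (g t); rewrite // cat_ffun_r ffunE enum_rankK.
Qed.

Hypothesis tfH : twin_free H.

Lemma thick_beta_aut k (phi psi : {ffun 'I_k -> H}) :
  thick phi -> hom_lab phi =1 hom_lab psi ->
  exists s : {perm H}, psi = post_comp phi s /\
    forall u v, beta (s u) (s v) = beta u v.
Proof.
move=> phiT e.
(* A label [a] over [v] other than [i] and [j] makes both edges to [a] available, so [phi i] and
   [phi j] are twins. *)
have psi_phi i j : psi i = psi j -> phi i = phi j.
  move=> pij; apply: tfH => v; have [//|a ai <-] := phiT v [:: i; j];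
    move: ai; rewrite !inE negb_or => /andP[ai aj].
    by rewrite !(hom_lab_eq_beta e) ?pij // eq_sym.
  by rewrite !(hom_lab_eq_beta e) ?pij.
have /choice[pre preP] (v : H) : exists i, phi i = v.
  by have [//|i _ <-] := phiT v [::]; exists i.
(* [pre] is a section of [phi], and [s] will be [psi \o pre], a permutation because [H] is
   finite. *)
have sinj : injective (psi \o pre).
  by move=> u v /psi_phi; rewrite !preP.
pose s := perm sinj.
have sP i : psi i = s (phi i).
  have iw : psi i = psi (pre (s^-1%g (psi i))) by rewrite -[LHS](permKV s) permE.
  by rewrite (psi_phi _ _ iw) preP permKV.
exists s; split=> [|u v]; first by apply/ffunP => i; rewrite ffunE.
(* Distinct labels over [u] and [v] are needed for an edge, even when [u = v]. *)
have [//|i _ <-] := phiT u [::]; have [//|j ij <-] := phiT v [:: i].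
rewrite -!sP (hom_lab_eq_beta e) //.
by move: ij; rewrite inE eq_sym.
Qed.

Lemma thick_aut k (phi psi : {ffun 'I_k -> H}) :
  thick phi -> hom_lab phi =1 hom_lab psi ->
  exists2 s, s \in wAut H & psi = post_comp phi s.
Proof.
move=> phiT e; have [s [psiE sb]] := thick_beta_aut phiT e.
subst psi; exists s => //; apply/wAutP; split=> // v.
pose Phi := cat_ffun phi [ffun=> v] : {ffun 'I_(k + 1) -> H}.
(* To be used for [t = 1] and [t = s]: at most one extension of [post_comp phi t] has the character
   of [Phi]. The permutation [t'] agrees with [t] because [phi] is onto. *)
have nuP (t : {perm H}) (nu : {ffun 'I_1 -> H}) :
    hom_lab (cat_ffun (post_comp phi t) nu) =1 hom_lab Phi -> nu = [ffun=> t v].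
  move=> eP.
  have [t' [tE _]] := thick_beta_aut (thick_cat [ffun=> v] phiT) (fsym eP).
  have t'E w : t' w = t w.
    have [//|i _ <-] := phiT w [::].
    have /ffunP/(_ (lshift 1 i)) := tE.
    by rewrite [RHS]ffunE !cat_ffun_l ffunE.
  apply/ffunP => j; have /ffunP/(_ (rshift k j)) := tE.
  by rewrite [RHS]ffunE !cat_ffun_r !ffunE t'E.
have wE w : map_weight ([ffun=> w] : {ffun 'I_1 -> H}) = alpha w.
  by rewrite /map_weight big_ord1 ffunE.
have phi1 : post_comp phi 1%g = phi by apply/ffunP => i; rewrite ffunE perm1.
have := class_weight_eq Phi e.
rewrite (big_pred1 [ffun=> v]) => [|nu]; last first.
  apply/asboolP/eqP => [|->//]; rewrite -{1}phi1 => /nuP ->.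
  by apply/ffunP => i; rewrite !ffunE perm1.
(* Only [s v] can contribute on the side of [psi]; if it did not, [alpha v] would be zero. *)
rewrite wE big_mkcond (bigD1 [ffun=> s v]) //= big1 => [|nu nuN]; last first.
  by case: asboolP => // /nuP nuE; rewrite nuE eqxx in nuN.
rewrite addr0 wE; case: asboolP => // _ /eqP.
by rewrite (negPf (alpha_neq0 v)).
Qed.

Hypothesis charF0 : [pchar F] =i pred0.

Lemma hom_lab_inj k (phi psi : {ffun 'I_k -> H}) :
  hom_lab phi =1 hom_lab psi ->
  exists2 s, s \in wAut H & psi = post_comp phi s.
Proof.
move=> e; have [l [nu0 /(_ k phi) PhiT]] := thick_extension.
set Phi := cat_ffun phi nu0 in PhiT.
have autP (p : {ffun 'I_k -> H}) nu : hom_lab (cat_ffun p nu) =1 hom_lab Phi ->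
    exists s, [/\ s \in wAut H, p = post_comp phi s & nu = post_comp nu0 s].
  move=> /fsym/(thick_aut PhiT)[s sA /ffunP sE].
  exists s; split=> //; apply/ffunP => i.
    by have := sE (lshift l i); rewrite [RHS]ffunE !cat_ffun_l ffunE.
  by have := sE (rshift k i); rewrite [RHS]ffunE !cat_ffun_r ffunE.
have := class_weight_eq Phi e.
(* On the side of [phi] all weights equal that of [nu0], which is itself in the class; in
   characteristic 0 their sum is nonzero, so the class on the side of [psi] cannot be empty. *)
rewrite (eq_bigr (fun _ => map_weight nu0)) => [|nu /asboolP/autP[s [sA _ ->]]].
  rewrite sumr_const.
  case: (pickP (fun nu => `[< hom_lab (cat_ffun psi nu) =1 hom_lab Phi >])).
    by move=> nu /asboolP/autP[s [sA -> _]] _; exists s.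
  move=> no_nu; rewrite [RHS]big_pred0 // => /eqP; rewrite -mulr_natr mulf_eq0.
  rewrite (negPf (map_weight_neq0 _)) /= (proj1 (pcharf0P F) charF0) => /eqP/card0_eq.
  by move=> /(_ nu0)/negbT/asboolP[].
by apply: eq_bigr => i _; rewrite ffunE (proj1 (wAutP _ sA)).
Qed.

End LabeledHomomorphisms.

(** * Orbits as indices of the distinct characters *)

Theorem theorem8p2 (F : fieldType) (charF0 : [pchar F] =i pred0)
    (H : wgraph F) (tfH : twin_free H) (k n : nat) (n_ge2 : (2 <= n)%N) :
  exists r : nat,
    gquot_alg_iso H k r /\
    has_dim (fun _ : gquot H k => True) r /\
    has_sym_rank (@conn_tensor F H k n) r /\
    has_tensor_rank (@conn_tensor F H k n) r /\
    has_rank (@conn_matrix F H k) r /\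
    has_rank (@hom_matrix F H k) r /\
    orb H k = r /\
    ((forall s : {perm H}, s \in wAut H -> s = 1%g) -> r = (#|H| ^ k)%N).
Proof.
pose orb_of := orbit (post_act H k) (wAut H).
have orbP phi psi : reflect (exists2 s, s \in wAut H & psi = post_comp phi s)
                            (psi \in orb_of phi).
  by apply: (iffP imsetP) => -[s sA ->]; exists s.
have orb_eq phi psi : (hom_lab phi =1 hom_lab psi) <-> (orb_of phi = orb_of psi).
  split=> [/(hom_lab_inj tfH charF0)/orbP/orbit_in_eqP orbE|e].
    exact/esym/orbE/subsetT.
  have /orbP[s sA ->] : psi \in orb_of phi by rewrite e; apply: orbit_refl.
  exact/fsym/hom_lab_wAut.
pose O := orb_of @: [set: {ffun 'I_k -> H}].
pose r := #|O|.
have /choice[rep repP] (i : 'I_r) : exists phi, enum_val i = orb_of phi.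
  by have /imsetP[phi _ ->] := enum_valP i; exists phi.
have /choice[cls clsP] phi : exists i : 'I_r, enum_val i = orb_of phi.
  have Ophi : orb_of phi \in O by apply/imset_f/in_setT.
  by exists (enum_rank_in Ophi (orb_of phi)); rewrite enum_rankK_in.
pose chi (i : 'I_r) : {mmorphism PLG (directed H) k -> F} := @hom_lab F H k (rep i).
have chi_inj i j : chi i =1 chi j -> i = j.
  by move=> /orb_eq e; apply: enum_val_inj; rewrite !repP.
have chi_cls phi : hom_lab phi =1 chi (cls phi).
  by apply/orb_eq; rewrite -clsP repP.
have cls_rep i : cls (rep i) = i by apply: enum_val_inj; rewrite clsP repP.
(* The coefficient of [chi i] in [whom] collects a whole orbit: its size times one common weight. *)
pose c (i : 'I_r) := \sum_(phi | cls phi == i) map_weight phi.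
have cN0 i : c i != 0.
  rewrite /c (eq_bigr (fun _ => map_weight (rep i))) => [|phi /eqP phii].
    rewrite sumr_const -mulr_natr mulf_neq0 ?map_weight_neq0 //.
    rewrite (proj1 (pcharf0P F) charF0) -lt0n; apply/card_gt0P.
    by exists (rep i); apply/eqP; rewrite cls_rep.
  have /orbP[s sA ->] : phi \in orb_of (rep i).
    by rewrite -repP -phii clsP; apply: orbit_refl.
  by apply: eq_bigr => u _; rewrite ffunE (proj1 (wAutP _ sA)).
have whomE g : whom g = \sum_i c i * chi i g.
  rewrite whom_sum (partition_big cls predT) //=; apply: eq_bigr => i _.
  by rewrite big_distrl; apply: eq_bigr => phi /eqP <-; rewrite chi_cls.
exists r; split; [|split; [|split; [|split; [|split; [|split; [|split]]]]]].
- exists (@fq_eval F _ r chi (@whom F H k)); split.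
  + exact: fq_eval_bij chi_inj cN0 whomE.
  + exact: fq_eval_linear chi_inj cN0 whomE.
  + exact: fq_eval_monoid_morphism chi_inj cN0 whomE.
- exact: has_dim_fquot chi_inj cN0 whomE.
- exact (has_sym_rank_characters chi_inj cN0 whomE n_ge2).
- exact (has_tensor_rank_characters chi_inj cN0 whomE n_ge2).
- have -> : @conn_matrix F H k = fun g h => whom (mmul g h).
    apply/funext => g; apply/funext => h; rewrite /conn_matrix /conn_tensor.
    by rewrite !big_ord_recl big_ord0 plg_mulr1.
  exact: has_rank_mul chi_inj cN0 whomE.
- apply: (has_rank_rows chi_inj) => [i|phi]; first by exists (rep i).
  by exists (cls phi).
- by [].
(* With a trivial group, distinct maps have distinct orbits, so [r] counts all maps. *)
- move=> Aut1; rewrite /r card_in_imset ?cardsT ?card_ffun ?card_ord //.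
  move=> phi psi _ _ e.
  have /orbP[s /Aut1 -> ->] : phi \in orb_of psi by rewrite -e; apply: orbit_refl.
  exact: post_comp1.
Qed.
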